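(* For any prime $p\equiv 1\mod 4$ and any integer $r\ge 1$, \begin{equation}{{}_2F_1\!\left(\begin{matrix}\frac{1-p^r}2,\ \frac {1}2\\ 1\end{matrix};\,2\right)}\big/{\,{}_2F_1\!\left(\begin{matrix}\frac{1-p^{r-1}}2,\ \frac {1}2\\ 1\end{matrix};\,2\right)}\equiv (-1)^{\frac{p^2-1}8} \frac{ \Gamma_p\left(\frac14\right)^2}{\Gamma_p\left(\frac12\right)} \mod p^{2r}. \end{equation}
   Context: Here $(a)_k=a(a+1)\cdots(a+k-1)$ is the rising factorial and ${}_{r+1}F_{r}\!\left(\begin{matrix}\alpha_1,\ldots,\alpha_{r+1}\\ \beta_1,\ldots,\beta_r\end{matrix};\,x\right)=\sum_{k\ge 0}\frac{(\alpha_1)_k\cdots(\alpha_{r+1})_k}{(\beta_1)_k\cdots(\beta_r)_k}\frac{x^k}{k!}$; when some $\alpha_i$ is a nonpositive integer (as $\frac{1-p^r}{2}$ is here) the sum terminates, so both series above are finite sums. $\Gamma_p$ denotes the Morita $p$-adic Gamma function. *)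

(* Defs.v *)
From HB Require Import structures.
From mathcomp Require Import all_boot all_order all_algebra.
From mathcomp Require Import mathcomp_extra boolp classical_sets functions.
From mathcomp Require Import cardinality fsbigop.

Set Implicit Arguments.
Unset Strict Implicit.
Unset Printing Implicit Defensive.

Import GRing.Theory.
Local Open Scope ring_scope.

Definition rising (F : fieldType) (a : F) (k : nat) : F :=
  \prod_(i < k) (a + i%:R).

(* \sum_(k \in A) is the finitely supported sum: the value below is that of the
   series when the series terminates, and 0 (junk) when it does not. *)
Definition hypergeometric (F : fieldType) (a b : seq F) (x : F) : F :=
  \sum_(k \in [set: nat]%classic)
    (\prod_(c <- a) rising c k) / (\prod_(c <- b) rising c k) *
    (x ^+ k / k`!%:R).

Definition hyp2F1 (F : fieldType) (a b c x : F) : F :=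
  hypergeometric [:: a; b] [:: c] x.

Lemma rising_oppn (F : fieldType) (n k : nat) :
  (n < k)%N -> rising (- n%:R : F) k = 0.
Proof.
by move=> nk; rewrite /rising (bigD1 (Ordinal nk)) //= addNr mul0r.
Qed.

Lemma hypergeometricE (F : fieldType) (n : nat) (a b : seq F) (x : F) :
  - n%:R \in a ->
  hypergeometric a b x =
    \sum_(k < n.+1) (\prod_(c <- a) rising c k) /
      (\prod_(c <- b) rising c k) * (x ^+ k / k`!%:R).
Proof.
move=> na; rewrite /hypergeometric.
rewrite (fsbigE (iota 0 n.+1)) ?iota_uniq //.
  by rewrite -(big_mkord xpredT (fun k => (\prod_(c <- a) rising c k) /
    (\prod_(c <- b) rising c k) * (x ^+ k / k`!%:R))) /index_iota subn0;
    apply: eq_bigl => k; rewrite in_setT.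
move=> k _; rewrite mem_iota /= add0n -leqNgt => nk.
by rewrite (big_rem _ na) /= rising_oppn // !mul0r.
Qed.

(* The ring of p-adic integers, as the inverse limit of the rings Z/p^(n+1):
   component n is the residue modulo p ^ n.+1 (so that component 0 already
   lives in a nontrivial ring). *)
Record padic_int (p : nat) (p_pr : prime p) := PadicInt {
  padic_trunc :> forall n, 'Z_(p ^ n.+1);
  padic_truncP : forall n, padic_trunc n.+1 = padic_trunc n %[mod p ^ n.+1]
}.

Section Padic.
Variables (p : nat) (p_pr : prime p).

Local Notation Zp := (padic_int p_pr).

Implicit Types x y z : Zp.

Local Lemma q_gt1 n : (1 < p ^ n.+1)%N.
Proof. by rewrite -(exp1n n.+1) ltn_exp2r // prime_gt1. Qed.
Local Hint Resolve q_gt1 : core.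

Local Lemma modq n m : (m %% p ^ n.+2 = m %[mod p ^ n.+1])%N.
Proof. by rewrite modn_dvdm // dvdn_exp2l. Qed.

Lemma padic_intP x y : (forall n, x n = y n) -> x = y.
Proof.
case: x y => [x xP] [y yP] /= xy.
have exy : x = y by apply: functional_extensionality_dep.
by case: _ / exy yP => yP; congr (PadicInt _); apply: Prop_irrelevance.
Qed.

Local Lemma val_add n (a b : 'Z_(p ^ n.+1)) :
  (a + b : 'Z_(p ^ n.+1)) = ((a + b) %% p ^ n.+1)%N :> nat.
Proof. exact: (congr1 (fun k => (a + b) %% k)%N (Zp_cast (q_gt1 n))). Qed.

Local Lemma val_mul n (a b : 'Z_(p ^ n.+1)) :
  (a * b : 'Z_(p ^ n.+1)) = ((a * b) %% p ^ n.+1)%N :> nat.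
Proof. exact: (congr1 (fun k => (a * b) %% k)%N (Zp_cast (q_gt1 n))). Qed.

Local Lemma val_opp n (a : 'Z_(p ^ n.+1)) :
  (- a : 'Z_(p ^ n.+1)) = ((p ^ n.+1 - a) %% p ^ n.+1)%N :> nat.
Proof. exact: (congr1 (fun k => (k - a) %% k)%N (Zp_cast (q_gt1 n))). Qed.

Local Lemma val_le n (a : 'Z_(p ^ n.+1)) : (a < p ^ n.+1)%N.
Proof. by have := ltn_ord a; rewrite [X in (_ < X)%N -> _]Zp_cast. Qed.

Lemma padic_nat_subproof m n :
  (m%:R : 'Z_(p ^ n.+2)) = (m%:R : 'Z_(p ^ n.+1)) %[mod p ^ n.+1].
Proof. by rewrite !val_Zp_nat // modq modn_mod. Qed.
Definition padic_nat m := PadicInt p_pr (padic_nat_subproof m).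

Lemma padic_add_subproof x y n :
  (x n.+1 + y n.+1 : 'Z_(p ^ n.+2))%R =
  (x n + y n : 'Z_(p ^ n.+1))%R %[mod p ^ n.+1].
Proof.
by rewrite !val_add modq modn_mod -modnDm !padic_truncP modnDm.
Qed.
Definition padic_add x y := PadicInt p_pr (padic_add_subproof x y).

Lemma padic_opp_subproof x n :
  (- x n.+1 : 'Z_(p ^ n.+2))%R = (- x n : 'Z_(p ^ n.+1))%R %[mod p ^ n.+1].
Proof.
rewrite !val_opp modq modn_mod; apply/eqP.
rewrite -(eqn_modDr (x n)) subnK; last exact/ltnW/val_le.
rewrite modnn -modnDmr -padic_truncP modnDmr subnK; last exact/ltnW/val_le.
by rewrite expnS modnMl.
Qed.
Definition padic_opp x := PadicInt p_pr (padic_opp_subproof x).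

Lemma padic_mul_subproof x y n :
  (x n.+1 * y n.+1 : 'Z_(p ^ n.+2))%R =
  (x n * y n : 'Z_(p ^ n.+1))%R %[mod p ^ n.+1].
Proof.
by rewrite !val_mul modq modn_mod -modnMm !padic_truncP modnMm.
Qed.
Definition padic_mul x y := PadicInt p_pr (padic_mul_subproof x y).

HB.instance Definition _ := gen_eqMixin Zp.
HB.instance Definition _ := gen_choiceMixin Zp.

Local Lemma addA : associative padic_add.
Proof. by move=> x y z; apply: padic_intP => n; exact: addrA. Qed.
Local Lemma addC : commutative padic_add.
Proof. by move=> x y; apply: padic_intP => n; exact: addrC. Qed.
Local Lemma add0 : left_id (padic_nat 0) padic_add.
Proof. by move=> x; apply: padic_intP => n; exact: add0r. Qed.
Local Lemma addN : left_inverse (padic_nat 0) padic_opp padic_add.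
Proof. by move=> x; apply: padic_intP => n; exact: addNr. Qed.

HB.instance Definition _ := GRing.isZmodule.Build Zp addA addC add0 addN.

Local Lemma mulA : associative padic_mul.
Proof. by move=> x y z; apply: padic_intP => n; exact: mulrA. Qed.
Local Lemma mulC : commutative padic_mul.
Proof. by move=> x y; apply: padic_intP => n; exact: mulrC. Qed.
Local Lemma mul1 : left_id (padic_nat 1) padic_mul.
Proof. by move=> x; apply: padic_intP => n; exact: mul1r. Qed.
Local Lemma mulDl : left_distributive padic_mul padic_add.
Proof. by move=> x y z; apply: padic_intP => n; exact: mulrDl. Qed.
Local Lemma one_neq0 : padic_nat 1 != 0.
Proof.
by apply/eqP => /(congr1 (fun x : Zp => x 0%N)) /eqP; rewrite oner_eq0.
Qed.

HB.instance Definition _ :=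
  GRing.Zmodule_isComNzRing.Build Zp mulA mulC mul1 mulDl one_neq0.

Lemma padic_truncD x y n : (x + y) n = x n + y n. Proof. by []. Qed.
Lemma padic_truncN x n : (- x) n = - x n. Proof. by []. Qed.
Lemma padic_truncM x y n : (x * y) n = x n * y n. Proof. by []. Qed.
Lemma padic_trunc0 n : (0 : Zp) n = 0. Proof. by []. Qed.
Lemma padic_trunc1 n : (1 : Zp) n = 1. Proof. by []. Qed.

Lemma padic_trunc_nat m n : (m%:R : Zp) n = m%:R.
Proof.
by elim: m => [//|m IHm]; rewrite !mulrSr padic_truncD IHm.
Qed.

Lemma padic_trunc_mod x m n :
  (m <= n)%N -> x n = x m %[mod p ^ m.+1].
Proof.
elim: n => [|n IHn]; first by rewrite leqn0 => /eqP ->.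
rewrite leq_eqVlt => /predU1P[-> //|]; rewrite ltnS => mn.
rewrite -IHn // -(modn_dvdm (x n.+1) (dvdn_exp2l p (_ : m.+1 <= n.+1)%N)) //.
by rewrite padic_truncP modn_dvdm // dvdn_exp2l.
Qed.

Local Lemma unitq n (a : 'Z_(p ^ n.+1)) : (a \is a GRing.unit) = ~~ (p %| a)%N.
Proof.
by rewrite -[a in LHS]natr_Zp unitZpE // coprime_pexpl // prime_coprime.
Qed.

Local Lemma unit_trunc x n : (x n \is a GRing.unit) = (x 0%N \is a GRing.unit).
Proof.
rewrite !unitq; congr (~~ _).
have h : (x n %% p = x 0 %% p)%N := padic_trunc_mod x (leq0n n).
by rewrite /dvdn h.
Qed.

Lemma padic_inv_subproof x n :
  ((x n.+1)^-1 : 'Z_(p ^ n.+2))%R = ((x n)^-1 : 'Z_(p ^ n.+1))%R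
    %[mod p ^ n.+1].
Proof.
have [ux|nux] := boolP (x 0%N \is a GRing.unit); last first.
  by rewrite !invr_out ?unit_trunc // padic_truncP.
have ux1 : x n.+1 \is a GRing.unit by rewrite unit_trunc.
have ux0 : x n \is a GRing.unit by rewrite unit_trunc.
have h (a : 'Z_(p ^ n.+1)) : a%:R = a by exact: natr_Zp.
suff : ((x n.+1)^-1%R : nat)%:R = (x n)^-1 :> 'Z_(p ^ n.+1).
  by move=> <-; rewrite val_Zp_nat // modn_mod.
apply: (mulrI ux0); rewrite divrr // -[x n in LHS]h.
have -> : (x n)%:R = (x n.+1 : nat)%:R :> 'Z_(p ^ n.+1).
  by apply/ord_inj; rewrite !val_Zp_nat // padic_truncP.
rewrite -natrM; apply/ord_inj; rewrite val_Zp_nat //.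
by rewrite -modq -val_mul divrr // /= modn_small // Zp_cast.
Qed.
Definition padic_inv x := PadicInt p_pr (padic_inv_subproof x).

Definition padic_unit : pred Zp := fun x => x 0%N \is a GRing.unit.

Local Lemma mulV : {in padic_unit, left_inverse 1 padic_inv *%R}.
Proof.
by move=> x ux; apply: padic_intP => n; apply: mulVr; rewrite unit_trunc.
Qed.
Local Lemma unitPl x y : y * x = 1 -> padic_unit x.
Proof.
move=> /(congr1 (fun x : Zp => x 0%N)) yx1.
by apply/unitrPr; exists (y 0%N); rewrite mulrC.
Qed.
Local Lemma inv_out : {in [predC padic_unit], padic_inv =1 id}.
Proof.
move=> x nux; apply: padic_intP => n; apply: invr_out.
by rewrite unit_trunc.
Qed.

HB.instance Definition _ :=
  GRing.ComNzRing_hasMulInverse.Build Zp mulV unitPl inv_out.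

Lemma padic_unitE x : (x \is a GRing.unit) = (x 0%N \is a GRing.unit).
Proof. by []. Qed.

Local Lemma neq0_logn x n : x n != 0 -> forall m, (n <= m)%N ->
  (0 < x m)%N /\ (logn p (x m) <= n)%N.
Proof.
move=> xn0 m nm; have ndvd : ~~ (p ^ n.+1 %| x m)%N.
  rewrite /dvdn (padic_trunc_mod x nm) modn_small ?val_le //.
have xm0 : (0 < x m)%N by rewrite lt0n; apply: contra ndvd => /eqP ->.
by split=> //; rewrite leqNgt -pfactor_dvdn.
Qed.

Local Lemma mul_eq0 x y : x * y = 0 -> (x == 0) || (y == 0).
Proof.
move=> xy0; apply: contrapT => /negP; rewrite negb_or => /andP[].
have ex z : z != 0 -> exists n, z n != 0.
  move=> /eqP z0; apply/not_existsP => zn; apply: z0.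
  by apply: padic_intP => n; apply/eqP/negbNE/negP/zn.
move=> /ex[m xm] /ex[n yn].
have [x0 lx] := neq0_logn xm (leq_addr n m).
have [y0 ly] := neq0_logn yn (leq_addl m n).
move/(congr1 (fun x : Zp => x (m + n)%N : nat)): xy0 => /eqP.
rewrite padic_truncM val_mul -/(dvdn _ _) pfactor_dvdn ?muln_gt0 ?x0 //.
by rewrite lognM // leqNgt ltnS leq_add.
Qed.

HB.instance Definition _ :=
  GRing.ComUnitRing_isIntegral.Build Zp mul_eq0.

Definition padic := {fraction Zp}.

(* Congruence modulo p ^ N of p-adic numbers: a - b lies in p ^ N Z_p. *)
Definition padic_eqmod (N : nat) (a b : padic) : Prop :=
  exists z : Zp, a - b = p%:R ^+ N * tofrac z.

Definition morita_prod (m : nat) : Zp :=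
  (-1) ^+ m * \prod_(1 <= j < m | ~~ (p %| j)%N) j%:R.

(* Morita's definition by continuity: l is the limit of morita_prod m when the
   natural number m tends p-adically to x. *)
Definition morita_lim x (l : Zp) : Prop :=
  forall N, exists M, forall m : nat,
    padic_eqmod M (tofrac m%:R) (tofrac x) ->
    padic_eqmod N (tofrac (morita_prod m)) (tofrac l).

Definition padic_gamma x : Zp := xget 0 (morita_lim x).

Lemma padic_nat_trunc x n : x n = (x n : nat)%:R.
Proof. by rewrite natr_Zp. Qed.

Lemma padic_trunc_eq0 x n : x n = 0 -> exists z, x = p%:R ^+ n.+1 * z.
Proof.
move=> xn0.
have dvdx k : (p ^ n.+1 %| x (k + n.+1)%N)%N.
  by rewrite /dvdn (@padic_trunc_mod x n) ?xn0 ?mod0n // addnS leqW ?leq_addl.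
pose w k := (x (k + n.+1) %/ p ^ n.+1)%N.
have wE k : (x (k + n.+1) = w k * p ^ n.+1 :> nat)%N by rewrite divnK.
have wP k : (w k.+1 = w k %[mod p ^ k.+1])%N.
  apply/eqP; rewrite -(@eqn_pmul2r (p ^ n.+1)) ?expn_gt0 ?prime_gt0 //.
  rewrite !muln_modl ?expn_gt0 ?prime_gt0 // -!wE -expnD addSn.
  exact/eqP/padic_truncP.
have zP k : ((w k.+1)%:R : 'Z_(p ^ k.+2)) = ((w k)%:R : 'Z_(p ^ k.+1))
    %[mod p ^ k.+1].
  by rewrite !val_Zp_nat // modq wP modn_mod.
exists (PadicInt p_pr zP); apply: padic_intP => k.
rewrite -natrX padic_truncM padic_trunc_nat /= -natrM; apply/ord_inj.
rewrite val_Zp_nat // mulnC -wE.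
by rewrite (@padic_trunc_mod x k) ?leq_addr // modn_small ?val_le.
Qed.

Lemma padic_eqmod_trunc n x y :
  padic_eqmod n.+1 (tofrac x) (tofrac y) <-> x n = y n.
Proof.
split=> [[z]|xyn].
  rewrite -tofracB -(rmorph_nat (tofrac (R:=Zp))) -rmorphXn -rmorphM.
  move=> /eqP; rewrite tofrac_eq => /eqP /(congr1 (fun x : Zp => x n)).
  rewrite -natrX padic_truncM padic_trunc_nat padic_truncD padic_truncN.
  by rewrite pchar_Zp // mul0r => /eqP; rewrite subr_eq0 => /eqP.
have /padic_trunc_eq0[z xyz] : (x - y) n = 0.
  by rewrite padic_truncD padic_truncN xyn subrr.
by exists z; rewrite -tofracB xyz rmorphM rmorphXn rmorph_nat.
Qed.

Local Definition G m : Zp := \prod_(0 <= j < m | ~~ (p %| j)%N) j%:R.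

Local Lemma moritaE m : morita_prod m = (-1) ^+ m * G m.
Proof.
rewrite /morita_prod /G; congr (_ * _).
by case: m => [|m]; [rewrite !big_geq|rewrite [RHS]big_ltn_cond // dvdn0].
Qed.

Local Lemma GS m : G m.+1 = G m * (if ~~ (p %| m)%N then m%:R else 1).
Proof. by rewrite /G big_mkcond big_nat_recr //= -big_mkcond. Qed.

Local Lemma GDq m n : G (p ^ n.+1 + m) n = G (p ^ n.+1) n * G m n.
Proof.
elim: m => [|m IHm]; first by rewrite addn0 {3}/G big_geq // padic_trunc1 mulr1.
rewrite addnS !GS !padic_truncM IHm -mulrA; congr (_ * (_ * _)).
rewrite dvdn_addr ?dvdn_exp //; case: ifP => // _.
by rewrite !padic_trunc_nat natrD pchar_Zp // add0r.
Qed.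

Local Lemma G_fact m : (m < p)%N -> G m.+1 = m`!%:R.
Proof.
elim: m => [_|m IHm mp]; first by rewrite GS dvdn0 /= mulr1 /G big_geq.
by rewrite GS IHm ?(ltnW mp) // gtnNdvd //= -natrM mulnC -factS.
Qed.

Local Lemma Gp : G p 0%N = -1.
Proof.
have p_gt0 := prime_gt0 p_pr.
rewrite -[X in G X](prednK p_gt0) G_fact ?prednK // padic_trunc_nat.
apply/eqP; rewrite -addr_eq0 natr1; apply/eqP/ord_inj; rewrite val_Zp_nat //=.
by apply/eqP; have := Wilson (prime_gt1 p_pr); rewrite p_pr => /esym.
Qed.

Hypothesis p_odd : odd p.

Local Lemma Gq0 n : G (p ^ n.+1) 0%N = -1.
Proof.
have H a : G (p * a) 0%N = G p 0%N ^+ a.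
  elim: a => [|a IHa]; first by rewrite muln0 /G big_geq // expr0.
  by rewrite mulnS exprS -IHa; exact: (GDq (p * a) 0).
by have := H (p ^ n)%N; rewrite Gp -signr_odd oddX p_odd orbT -expnS.
Qed.

Local Lemma Gq n : G (p ^ n.+1) n = -1.
Proof.
have GE : G (p ^ n.+1) n = \prod_(u : 'Z_(p ^ n.+1) | u \is a GRing.unit) u.
  have -> : G (p ^ n.+1) n = \prod_(0 <= j < p ^ n.+1 | ~~ (p %| j)%N) j%:R.
    rewrite /G.
    rewrite (big_morph (fun x : Zp => x n) (id1 := 1) (op1 := *%R)) //.
    by apply: eq_bigr => j _; rewrite padic_trunc_nat.
  rewrite big_mkord.
  pose f := cast_ord (esym (Zp_cast (q_gt1 n))).
  pose g := cast_ord (Zp_cast (q_gt1 n)).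
  rewrite (reindex g) /=; last first.
    by exists f => i _; apply: ord_inj.
  by apply: eq_big => [i|i _]; [rewrite unitq | rewrite natr_Zp].
have G2 : G (p ^ n.+1) n * G (p ^ n.+1) n = 1.
  rewrite {2}GE (reindex_inj (can_inj (@invrK _))) /=.
  under eq_bigl do rewrite unitrV.
  by rewrite GE -big_split /= big1 // => u uu; rewrite divrr.
have : (G (p ^ n.+1) n - 1) * (G (p ^ n.+1) n + 1) = 0.
  by rewrite -subr_sqr_1 expr2 G2 subrr.
have u1 : (G (p ^ n.+1) - 1) \is a GRing.unit.
  rewrite padic_unitE padic_truncD Gq0 -opprD unitrN.
  have -> : 1 + 1 = 2%:R :> 'Z_(p ^ 1) by [].
  by rewrite unitZpE ?q_gt1 // coprime_pexpl // coprimen2.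
have u2 : (G (p ^ n.+1) n - 1) \is a GRing.unit.
  by rewrite -padic_trunc1 -padic_truncN -padic_truncD unit_trunc.
rewrite -(mulr0 (G (p ^ n.+1) n - 1)) => /(mulrI u2) /eqP.
by rewrite addr_eq0 => /eqP.
Qed.

Local Lemma moritaDq m n : morita_prod (p ^ n.+1 + m) n = morita_prod m n.
Proof.
rewrite !moritaE !padic_truncM GDq Gq exprD -signr_odd oddX p_odd orbT /=.
by rewrite !mulN1r mulrNN.
Qed.

Lemma morita_prod_mod n m m' :
  m = m' %[mod p ^ n.+1] -> morita_prod m n = morita_prod m' n.
Proof.
have H k : morita_prod k n = morita_prod (k %% p ^ n.+1) n.
  rewrite {1}(divn_eq k (p ^ n.+1)).
  elim: (k %/ _)%N => [|a IHa]; first by rewrite mul0n.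
  by rewrite mulSn -addnA moritaDq.
by move=> mm'; rewrite H mm' -H.
Qed.

Local Lemma gamma_subproof x n :
  (morita_prod (x n.+1) n.+1) = (morita_prod (x n) n) %[mod p ^ n.+1].
Proof.
rewrite padic_truncP; congr (nat_of_ord _ %% _)%N.
exact/morita_prod_mod/padic_truncP.
Qed.

Lemma morita_limP x l :
  morita_lim x l <-> forall n, l n = morita_prod (x n) n.
Proof.
split=> [xl n|lE].
  have [M HM] := xl n.+1.
  have /HM/padic_eqmod_trunc <- :
      padic_eqmod M (tofrac (x (M + n)%N)%:R) (tofrac x).
    case: M HM => [|M] _.
      by exists ((x (0 + n)%N)%:R - x); rewrite expr0 mul1r tofracB.
    apply/padic_eqmod_trunc; rewrite padic_trunc_nat [RHS]padic_nat_trunc.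
    apply/ord_inj; rewrite !val_Zp_nat //.
    by apply: padic_trunc_mod; rewrite addSn -addnS leq_addr.
  by apply: morita_prod_mod; apply: padic_trunc_mod; rewrite leq_addl.
move=> [|n].
  by exists 0%N => m _; exists (morita_prod m - l); rewrite expr0 mul1r tofracB.
exists n.+1 => m /padic_eqmod_trunc mx; apply/padic_eqmod_trunc.
rewrite lE; apply: morita_prod_mod; move: mx; rewrite padic_trunc_nat => <-.
by rewrite val_Zp_nat // modn_mod.
Qed.

Lemma padic_gammaP x : morita_lim x (padic_gamma x).
Proof.
apply: (@xgetPex _ _ (morita_lim x)).
by exists (PadicInt p_pr (gamma_subproof x)); apply/morita_limP.
Qed.

Lemma padic_gamma_unique x l : morita_lim x l -> padic_gamma x = l.
Proof.
move=> /morita_limP lE; apply: padic_intP => n.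
by rewrite lE; move: n; apply/morita_limP; exact: padic_gammaP.
Qed.

Lemma padic_gamma_nat m : padic_gamma m%:R = morita_prod m.
Proof.
apply: padic_gamma_unique; apply/morita_limP => n.
by apply: morita_prod_mod; rewrite padic_trunc_nat val_Zp_nat // modn_mod.
Qed.

End Padic.

(* Main.v *)
Require Import Defs.
From HB Require Import structures.
From mathcomp Require Import all_boot all_order all_algebra.
From mathcomp Require Import ring zify.

Set Implicit Arguments.
Unset Strict Implicit.
Unset Printing Implicit Defensive.

Import GRing.Theory.
Local Open Scope ring_scope.

(* Write p^r = 4 m + 1. The terminating series is C(2m, m) / 4^m = (1/2)_m / m!.
   In passing from r - 1 to r the nonunit factors of (1/2)_m and of m!
   contribute the corresponding products for r - 1, up to the same power of p,
   so the quotient is the one of the unit factors, namely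
   - Gamma_p(1/2 + m) / (Gamma_p(1/2) Gamma_p(1 + m)). By the reflection formula
   this is, up to sign, Gamma_p(1/4 + x) Gamma_p(1/4 - x) / Gamma_p(1/2) with
   x = p^r / 4. Finally Gamma_p(a + x) Gamma_p(a - x) = Gamma_p(a)^2 modulo x^2. *)

(** * Characteristic zero and the transfer of rational fractions *)

Lemma padic_natr_eq0 (p : nat) (p_pr : prime p) (k : nat) :
  (k%:R == 0 :> padic_int p_pr) = (k == 0%N).
Proof.
apply/eqP/eqP => [k0|->//].
(* Since [k] is below p^(k+1), reduction at level [k] loses nothing, and a zero component there
   forces k = 0. *)
have kp : (k < p ^ k.+1)%N.
  exact: leq_trans (ltn_expl k (prime_gt1 p_pr)) (leq_pexp2l (prime_gt0 p_pr) _).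
have /(congr1 (fun x : padic_int p_pr => x k : nat)) := k0.
rewrite padic_trunc_nat val_Zp_nat ?modn_small //.
by rewrite -(exp1n k.+1) ltn_exp2r // prime_gt1.
Qed.

(** [ratr] goes through the reduced fraction, and cross multiplication by [denq] compares it with a
    / b. For b = 0 both sides take the default value 0. *)
Lemma ratr_div_nat (F : fieldType) (a b : nat) :
  [pchar F] =i pred0 -> ratr (a%:R / b%:R) = a%:R / b%:R :> F.
Proof.
move=> /pcharf0P F0; have [->|b0] := eqVneq b 0%N.
  by rewrite !mulr0n !invr0 !mulr0 (ratr_nat _ 0).
set x : rat := a%:R / b%:R.
have dF : (denq x)%:~R != 0 :> F.
  rewrite -[denq x]gez0_abs; first by rewrite F0 absz_eq0 denq_eq0.
  exact/Order.POrderTheory.ltW/denq_gt0.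
have bF : b%:R != 0 :> F by rewrite F0.
have bQ : b%:R != 0 :> rat by rewrite Num.Theory.pnatr_eq0.
have E : numq x * b%:R = a%:R * denq x.
  apply/eqP; rewrite -(eqr_int rat) !rmorphM /= !rmorph_nat; apply/eqP.
  by rewrite numqE mulrAC divfK.
apply/eqP; rewrite /ratr eqr_div //; apply/eqP.
have /(congr1 (fun z : int => z%:~R : F)) := E.
by rewrite !rmorphM /= !rmorph_nat.
Qed.

(** * Evaluation of the terminating series *)

Lemma coef_expr_XnD1 (R : nzRingType) (c j k : nat) :
  (0 < c)%N -> (('X^c + 1 : {poly R}) ^+ j)`_(c * k) = 'C(j, k)%:R.
Proof.
move=> c0; rewrite exprD1n coef_sum.
under eq_bigr => i _ do rewrite coefMn -exprM coefXn eqn_mul2l eqn0Ngt c0 /=.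
have [kj|jk] := leqP k j; last first.
  rewrite bin_small // big1 // => i _.
  by rewrite gtn_eqF ?mul0rn // (leq_trans (ltn_ord i)).
have kj1 : (k < j.+1)%N by [].
rewrite (bigD1 (Ordinal kj1)) //= eqxx big1 ?addr0 // => i /eqP ik.
case: eqP => [ki|]; last by rewrite mul0rn.
by case: ik; apply/ord_inj.
Qed.

(* The constant term of (1 - (t + 1/t)^2 / 2)^n = (- (t^2 + t^-2) / 2)^n,
   with 'X standing for t^2. *)
Lemma alternating_central_binomial_sum (F : fieldType) (m : nat) :
  2%:R != 0 :> F ->
  \sum_(k < (2 * m).+1) ('C(2 * m, k) * 'C(2 * k, k))%:R * (- 2%:R^-1) ^+ k =
    'C(2 * m, m)%:R / 4%:R ^+ m :> F.
Proof.
move=> F2; set n := (2 * m)%N; set h : F := - 2%:R^-1.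
have h2 : h *+ 2 = -1 by rewrite -mulr_natr mulNr mulVf.
(* Each base is multiplied by 'X, so the constant term becomes the coefficient of degree n. The two
   bases differ by (2 h + 1) 'X = 0. *)
have E : ('X + h *: ('X + 1) ^+ 2) ^+ n = (h *: ('X^2 + 1)) ^+ n :> {poly F}.
  have H2 : h%:P *+ 2 + 1 = 0 by rewrite -polyCMn h2 polyCN addNr.
  congr (_ ^+ n); rewrite -!mul_polyC.
  by rewrite -[RHS]addr0 -(mul0r 'X) -H2; ring.
have /(congr1 (fun P : {poly F} => P`_(2 * m))) := E.
rewrite exprZn coefZ coef_expr_XnD1 // => El.
have -> : 'C(2 * m, m)%:R / 4%:R ^+ m = h ^+ n * 'C(n, m)%:R.
  rewrite mulrC; congr (_ * _).
  by rewrite exprM sqrrN exprVn -exprVn -natrX.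
(* Term k is a binomial coefficient times 'X^(n - k) h^k ('X + 1)^(2 k), and C(2 k, k) is the middle
   coefficient of the last power. *)
rewrite -El exprDn coef_sum; apply: eq_bigr => k _.
rewrite coefMn exprZn -scalerAr coefZ coefXnM -/n ltnNge leq_subr /=.
have kn : (k <= n)%N by rewrite -ltnS.
rewrite subKn // -exprM -[k in _`_k]mul1n.
rewrite -['X]expr1 coef_expr_XnD1 // natrM -mulr_natl; by ring.
Qed.

(** A domain suffices, so this serves both the field of the series and Z_p. Multiplied by n!, the
    right side is (2 n)!, and 4 (h + n) (n + 1) = (2 n + 1) (2 n + 2) gives the induction. *)
Lemma pochhammer_half (R : idomainType) (h : R) (n : nat) :
  (forall k, (k%:R == 0 :> R) = (k == 0%N)) -> h * 2%:R = 1 ->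
  (\prod_(k < n) (h + k%:R)) * 4%:R ^+ n = ('C(2 * n, n) * n`!)%:R.
Proof.
move=> R0 h2.
have fact0 k : k`!%:R != 0 :> R by rewrite R0 -lt0n fact_gt0.
apply: (mulIf (fact0 n)).
rewrite -natrM -mulnA; have -> : ('C(2 * n, n) * (n`! * n`!) = (2 * n)`!)%N.
  by rewrite mul2n -addnn -[RHS](bin_fact (leq_addr n n)) addnK.
elim: n => [|n IHn]; first by rewrite big_ord0 expr0 !mulr1.
rewrite big_ord_recr /= (_ : 2 * n.+1 = (2 * n).+2)%N; last by lia.
rewrite !factS !natrM -IHn exprS -[n.+1]addn1 -[(2 * n).+2]addn2 -[(2 * n).+1]addn1.
rewrite (natrD _ (2 * n) 2) (natrD _ (2 * n) 1) (natrD _ n 1) natrM.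
rewrite (_ : 4%:R = 2%:R * 2%:R :> R); last by rewrite -natrM.
set P := \prod_(_ < _) _; set Q := (2%:R * 2%:R) ^+ n.
transitivity (P * Q * n`!%:R * (n%:R + 1) * (2%:R * (h * 2%:R + 2%:R * n%:R))); first by ring.
by rewrite h2; ring.
Qed.

Lemma rising_opp_natr (F : fieldType) (n k : nat) :
  (k <= n)%N -> rising (- n%:R : F) k = (-1) ^+ k * ('C(n, k) * k`!)%:R.
Proof.
rewrite bin_ffact /rising; elim: k => [|k IHk] kn.
  by rewrite big_ord0 expr0 mulr1.
rewrite big_ord_recr /= IHk ?(ltnW kn) // ffactnSr natrM natrB ?(ltnW kn) // exprS.
by ring.
Qed.

Lemma rising_one (F : fieldType) (k : nat) : rising (1 : F) k = k`!%:R.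
Proof.
rewrite /rising; elim: k => [|k IHk]; first by rewrite big_ord0.
by rewrite big_ord_recr /= IHk factS natrM mulrC nat1r.
Qed.

(** In term k the factorials cancel and 2^k / 4^k with the sign of (-2 m)_k gives (-1/2)^k, the
    summand of [alternating_central_binomial_sum]. *)
Lemma hyp2F1_half_2 (F : fieldType) (m : nat) :
  [pchar F] =i pred0 ->
  hyp2F1 (- (2 * m)%:R) (1 / 2%:R) 1 2%:R = 'C(2 * m, m)%:R / 4%:R ^+ m :> F.
Proof.
move=> /pcharf0P F0.
have F2 : 2%:R != 0 :> F by rewrite F0.
have F4 : 4%:R != 0 :> F by rewrite F0.
rewrite -alternating_central_binomial_sum // /hyp2F1.
rewrite (hypergeometricE (n := 2 * m)) ?mem_head //; apply: eq_bigr => k _.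
have kfact0 : k`!%:R != 0 :> F by rewrite F0 -lt0n fact_gt0.
have kn : (k <= 2 * m)%N by rewrite -ltnS.
rewrite !big_cons !big_nil !mulr1 rising_one rising_opp_natr //.
have -> : rising (1 / 2%:R) k = ('C(2 * k, k) * k`!)%:R / 4%:R ^+ k :> F.
  apply: (canRL (mulfK _)); first by rewrite expf_neq0.
  by rewrite pochhammer_half // divfK.
have -> : 4%:R ^+ k = 2%:R ^+ k * 2%:R ^+ k :> F by rewrite -exprMn -natrM.
rewrite [X in _ = _ * X]exprNn exprVn !natrM.
have : 2%:R ^+ k != 0 :> F by rewrite expf_neq0.
move: (2%:R ^+ k) => t t0.
by field; rewrite t0.
Qed.

(** * Units and residues of p-adic integers *)

Section PadicGamma.
Variables (p : nat) (p_pr : prime p).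
Local Notation Zp := (padic_int p_pr).
Local Notation Gamma := (@padic_gamma p p_pr).
Implicit Types (a b x y : Zp) (n : nat).

Lemma prime_expnS_gt1 n : (1 < p ^ n.+1)%N.
Proof. by rewrite -(exp1n n.+1) ltn_exp2r // prime_gt1. Qed.
#[local] Hint Resolve prime_expnS_gt1 : core.

Lemma padic_nat_unit k : ((k%:R : Zp) \is a GRing.unit) = ~~ (p %| k)%N.
Proof.
by rewrite padic_unitE padic_trunc_nat unitZpE // coprime_pexpl // prime_coprime.
Qed.

Lemma padic_trunc_unit x n :
  (x \is a GRing.unit) = (((x n : nat)%:R : Zp) \is a GRing.unit).
Proof.
rewrite padic_unitE [x 0%N]padic_nat_trunc -(padic_trunc_nat p_pr) -padic_unitE.
rewrite !padic_nat_unit; congr (~~ _).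
have h : (x n %% p = x 0 %% p)%N := padic_trunc_mod x (leq0n n).
by rewrite /dvdn h.
Qed.

Lemma padic_unit_neq0 x : (x \is a GRing.unit) = (x 0%N != 0).
Proof.
rewrite (padic_trunc_unit x 0) padic_nat_unit; congr (~~ _).
have : (x 0%N < p ^ 1)%N by rewrite -[X in (_ < X)%N](Zp_cast (prime_expnS_gt1 0)).
by rewrite [X in (_ < X)%N]expn1 => xp; rewrite /dvdn modn_small.
Qed.

Lemma morita_prodS n :
  morita_prod p_pr n.+1 =
  - (if (n%:R : Zp) \is a GRing.unit then n%:R else 1) * morita_prod p_pr n.
Proof.
rewrite padic_nat_unit /morita_prod; case: n => [|n].
  by rewrite dvdn0 /= !big_geq // expr1 expr0 !mulr1.
rewrite big_mkcond big_nat_recr //= -big_mkcond /= exprS.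
by rewrite mulN1r !mulNr mulrA [in RHS]mulrC.
Qed.

(** * Functional equation and reflection formula for Gamma_p *)

Section Odd.
Hypothesis p_odd : odd p.

Lemma padic_gamma_trunc x n : Gamma x n = morita_prod p_pr (x n) n.
Proof. by move: n; apply/(morita_limP p_odd)/padic_gammaP. Qed.

(** This carries identities from natural numbers to Z_p: at level n, [x] may be replaced by the
    natural number [x n]. *)
Lemma padic_gamma_cont x y n : x n = y n -> Gamma x n = Gamma y n.
Proof. by rewrite !padic_gamma_trunc => ->. Qed.

Lemma trunc_nat_self x n : ((x n : nat)%:R : Zp) n = x n.
Proof. by rewrite padic_trunc_nat -padic_nat_trunc. Qed.

Lemma padic_gamma0 : Gamma 0 = 1.
Proof.
by rewrite -[0]/(0%:R) padic_gamma_nat // /morita_prod big_geq // mulr1.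
Qed.

Lemma padic_gammaS x :
  Gamma (x + 1) = - (if x \is a GRing.unit then x else 1) * Gamma x.
Proof.
apply: padic_intP => n; set k : nat := x n.
have kx : (k%:R : Zp) n = x n := trunc_nat_self x n.
have -> : Gamma (x + 1) n = Gamma k.+1%:R n.
  by apply: padic_gamma_cont; rewrite padic_truncD -kx -padic_truncD natr1.
rewrite padic_gamma_nat // morita_prodS -(padic_gamma_nat p_pr p_odd).
rewrite !padic_truncM !padic_truncN (padic_gamma_cont kx).
by rewrite (padic_trunc_unit x n); case: ifP => _ //; rewrite kx.
Qed.

Lemma padic_gamma1 : Gamma 1 = -1.
Proof.
by rewrite -[in LHS](add0r 1) padic_gammaS padic_gamma0 unitr0 mulr1.
Qed.

Lemma padic_gammaDn a n :
  Gamma (a + n%:R) = (-1) ^+ n * Gamma a *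
    \prod_(k < n | (a + k%:R) \is a GRing.unit) (a + k%:R).
Proof.
elim: n => [|n IHn]; first by rewrite addr0 big_ord0 expr0 mul1r mulr1.
rewrite -natr1 addrA padic_gammaS IHn [in RHS]big_mkcond big_ord_recr /=.
by rewrite -big_mkcond exprS; case: ifP => _; ring.
Qed.

Definition gamma_reflection x := Gamma x * Gamma (1 - x).

(** For a unit x, Gamma(x + 1) = -x Gamma(x) while Gamma(1 - x) = x Gamma(-x), so only a sign
    survives. *)
Lemma gamma_reflectionS x :
  gamma_reflection (x + 1) =
  if x \is a GRing.unit then - gamma_reflection x else gamma_reflection x.
Proof.
rewrite /gamma_reflection padic_gammaS opprD addrA [1 - x]addrC addrK.
by rewrite padic_gammaS unitrN; case: ifP => _; ring.
Qed.

Lemma gamma_reflection_trunc x y n :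
  x n = y n -> gamma_reflection x n = gamma_reflection y n.
Proof.
move=> xy; rewrite /gamma_reflection !padic_truncM; congr (_ * _).
  exact: padic_gamma_cont.
by apply: padic_gamma_cont; rewrite !padic_truncD !padic_truncN xy.
Qed.

Lemma gamma_reflectionC x : gamma_reflection (1 - x) = gamma_reflection x.
Proof. by rewrite /gamma_reflection subKr mulrC. Qed.

Lemma gamma_reflection0 : gamma_reflection 0 = -1.
Proof. by rewrite /gamma_reflection subr0 padic_gamma0 padic_gamma1 mul1r. Qed.

Lemma gamma_reflection_sqr x : gamma_reflection x ^+ 2 = 1.
Proof.
have R2 k : gamma_reflection k%:R ^+ 2 = 1.
  elim: k => [|k IHk]; first by rewrite gamma_reflection0 sqrrN expr1n.
  by rewrite -natr1 gamma_reflectionS; case: ifP => _ //; rewrite sqrrN.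
apply: padic_intP => n; rewrite -(R2 (x n)) !expr2.
have := gamma_reflection_trunc (trunc_nat_self x n).
by move: (gamma_reflection _) (gamma_reflection _) => u v uv; rewrite !padic_truncM uv.
Qed.

(** Both values are signs by [gamma_reflection_sqr], and 1 and -1 stay distinct modulo the odd prime
    p. *)
Lemma gamma_reflection_eq x y :
  x 0%N = y 0%N -> gamma_reflection x = gamma_reflection y.
Proof.
move=> /gamma_reflection_trunc.
have pm z : gamma_reflection z = 1 \/ gamma_reflection z = -1.
  have /orP[/eqP|/eqP] : (gamma_reflection z == 1) || (gamma_reflection z == -1).
  - by rewrite -sqrf_eq1 gamma_reflection_sqr.
  - by left.
  - by right.
have n11 : (1 : Zp) 0%N <> (-1 : Zp) 0%N.
  have u2 : (2%:R : Zp) 0%N != 0.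
    rewrite -padic_unit_neq0 padic_nat_unit dvdn_prime2 //.
    by case: eqP p_odd => // ->.
  by move=> e; case/eqP: u2; rewrite mulr2n padic_truncD {1}e padic_truncN addNr.
by case: (pm x) => ->; case: (pm y) => -> // /esym.
Qed.

(** Starting from -1 at 0, the shift at the nonunit 0 keeps the sign and those at the units 1, ...,
    k flip it. *)
Lemma gamma_reflection_nat k :
  (k < p)%N -> gamma_reflection k.+1%:R = (-1) ^+ k.+1.
Proof.
elim: k => [|k IHk] kp.
  by rewrite -natr1 gamma_reflectionS unitr0 gamma_reflection0 expr1.
rewrite -natr1 gamma_reflectionS IHk ?(ltnW kp) // padic_nat_unit.
by rewrite gtnNdvd //= [in RHS]exprS mulN1r.
Qed.

(* For natural a, the quotient of both sides is unchanged modulo x^2 when a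
   increases by 1, since (a + x) (a - x) = a^2 - x^2; at a = 0 the identity is
   the reflection formula. *)
Lemma padic_gamma_even a x n :
  x 0%N = 0 -> (x * x) n = 0 ->
  (Gamma (a + x) * Gamma (a - x)) n = (Gamma a ^+ 2) n.
Proof.
move=> x0 x2.
have unitD (k y : Zp) : y 0%N = 0 -> ((k + y) \is a GRing.unit) = (k \is a GRing.unit).
  by move=> y0; rewrite !padic_unit_neq0 padic_truncD y0 addr0.
have nx0 : (- x) 0%N = 0 by rewrite padic_truncN x0 oppr0.
have H k : (Gamma (k%:R + x) * Gamma (k%:R - x)) n = (Gamma k%:R ^+ 2) n.
  elim: k => [|k IHk].
    rewrite !add0r padic_gamma0 expr1n.
    have /eqP := gamma_reflection_eq (x := x) (y := 0) x0.
    rewrite gamma_reflection0 /gamma_reflection [1 - x]addrC padic_gammaS.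
    rewrite padic_unit_neq0 nx0 eqxx /= mulN1r mulrN eqr_opp => /eqP GG.
    by rewrite -padic_truncM GG.
  rewrite -!natr1 ![_ + 1 + _]addrAC !padic_gammaS !unitD // exprMn.
  rewrite mulrACA padic_truncM IHk [RHS]padic_truncM; congr (_ * _).
  case: ifP => _ //; rewrite mulrNN sqrrN.
  have -> : (k%:R + x) * (k%:R - x) = k%:R ^+ 2 - x * x :> Zp by ring.
  by rewrite padic_truncD padic_truncN x2 subr0.
have Da := trunc_nat_self a n; have := H (a n).
have Dp : ((a n : nat)%:R + x) n = (a + x) n by rewrite !padic_truncD Da.
have Dm : ((a n : nat)%:R - x) n = (a - x) n by rewrite !padic_truncD Da.
rewrite !expr2 !padic_truncM (padic_gamma_cont Da).
by rewrite (padic_gamma_cont Dp) (padic_gamma_cont Dm).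
Qed.

Lemma padic_gamma_unit x : Gamma x \is a GRing.unit.
Proof.
have := gamma_reflection_sqr x; rewrite expr2 {1}/gamma_reflection -mulrA.
by move=> G1; apply/unitrPr; eexists; exact: G1.
Qed.

End Odd.

(** * Nonunit factors and the ratio of central binomial coefficients *)

(* Among a, a + 1, ... the nonunits are the a + s + p i = p (b + i). *)
Lemma prod_nonunit a b s t n :
  (t <= s < p)%N -> a + s%:R = p%:R * b ->
  \prod_(k < p * n + t | (a + k%:R) \isn't a GRing.unit) (a + k%:R) =
  p%:R ^+ n * \prod_(k < n) (b + k%:R).
Proof.
move=> /andP[ts sp] ab.
have p0 : (p%:R : Zp) 0%N = 0.
  by apply/eqP/negbFE; rewrite -padic_unit_neq0 padic_nat_unit dvdnn.
have nu k : ((a + k%:R) \isn't a GRing.unit) = (k == s %[mod p])%N.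
  rewrite padic_unit_neq0 negbK.
  have -> : (a + k%:R) 0%N = k%:R - s%:R.
    rewrite padic_truncD padic_trunc_nat addrC; congr (_ + _).
    apply/eqP; rewrite -addr_eq0 -(padic_trunc_nat p_pr s) -padic_truncD ab.
    by rewrite padic_truncM p0 mul0r.
  rewrite subr_eq0; apply/eqP/eqP => [/(congr1 val)|ks].
    by rewrite /= !val_Zp_nat // expn1.
  by apply/ord_inj; rewrite !val_Zp_nat // expn1.
under eq_bigl do rewrite nu.
elim: n => [|n IHn].
  (* As t <= s, no index below t lies in the class of s modulo p. *)
  rewrite muln0 add0n big_ord0 expr0 mulr1 big1 // => k.
  have kt := ltn_ord k.
  rewrite !modn_small //; last by lia.
  by move/eqP; lia.
rewrite mulnSr -addnA [(p + t)%N]addnC addnA.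
rewrite -(big_mkord (fun k => k == s %[mod p])%N (fun k => a + k%:R)).
rewrite (big_cat_nat _ (n := p * n + t)) ?leq_addr //= big_mkord IHn.
rewrite big_ord_recr /= exprSr -!mulrA; congr (_ * _).
rewrite mulrCA; congr (_ * _).
(* The new block of p indices meets the class of s only at p n + s, where the factor is p (b +
   n). *)
rewrite big_mkcond (bigD1_seq (p * n + s)%N) ?iota_uniq //=; last first.
  by rewrite mem_index_iota; lia.
rewrite mulnC modnMDl eqxx natrD natrM big1_seq => [|k /andP[kne]].
  by rewrite mulr1 addrCA ab; ring.
rewrite mem_index_iota => kr; case: eqP => // ks; exfalso.
have := divn_eq k p; rewrite ks (modn_small sp); move: (k %/ p)%N => d kE.
have p_gt0 := prime_gt0 p_pr.
have dn : (d < n.+1)%N by rewrite -(ltn_pmul2r p_gt0) mulSn [(n * p)%N]mulnC; lia.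
have nd : (n < d.+1)%N by rewrite -(ltn_pmul2r p_gt0) mulSn [(n * p)%N]mulnC; lia.
have dE : d = n by lia.
by rewrite kE dE [(n * p)%N]mulnC eqxx in kne.
Qed.

Lemma padic_trunc_pX_eq0 n N (z : Zp) : (n < N)%N -> (p%:R ^+ N * z) n = 0.
Proof.
move=> nN; rewrite -(subnKC nN) exprD -mulrA padic_truncM -natrX padic_trunc_nat.
by rewrite pchar_Zp ?mul0r // prime_expnS_gt1.
Qed.

Lemma pchar_padic : [pchar padic p_pr] =i pred0.
Proof.
apply/pcharf0P => n.
by rewrite -(rmorph_nat (tofrac (R:=Zp))) tofrac_eq0 padic_natr_eq0.
Qed.

(** This is exact and holds for every n; precision is lost only later, in [padic_gamma_even].
    Denominators are cleared to stay inside Z_p. *)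
Lemma central_binomial_ratio (s n : nat) :
  p = (4 * s + 1)%N -> let m := (p * n + s)%N in
  ('C(2 * m, m) * 4 ^ n)%:R = ('C(2 * n, n) * 4 ^ m)%:R *
    ((-1) ^+ s * (Gamma (1 / 2%:R + m%:R) * Gamma (- m%:R)) / Gamma (1 / 2%:R)).
Proof.
move=> ps m.
have p_odd : odd p by rewrite ps; lia.
have p_gt1 := prime_gt1 p_pr.
have Z0 := padic_natr_eq0 p_pr.
set h : Zp := 1 / 2%:R.
have h2 : h * 2%:R = 1.
  by rewrite divrK // padic_nat_unit dvdn_prime2 //; lia.
have fact_prod k : k`!%:R = \prod_(i < k) (1 + i%:R) :> Zp.
  elim: k => [|k IHk]; first by rewrite big_ord0.
  by rewrite big_ord_recr /= -IHk factS natrM nat1r mulrC.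
pose U (a : Zp) := \prod_(k < m | (a + k%:R) \is a GRing.unit) (a + k%:R).
have Ph := pochhammer_half m Z0 h2; have Pn := pochhammer_half n Z0 h2.
have F := fact_prod m.
rewrite (bigID (fun k : 'I_m => (h + k%:R) \is a GRing.unit)) /= -/(U h) in Ph.
rewrite (bigID (fun k : 'I_m => (1 + k%:R : Zp) \is a GRing.unit)) /= -/(U 1) in F.
have pR : p%:R = 4%:R * s%:R + 1 :> Zp by rewrite -natrM natr1 -addn1 -ps.
(* The first multiple of p is p h, at index 2 s, in the product from h, and p, at index 4 s, in the
   product from 1. Both indices are at least s, as [prod_nonunit] requires with t = s. *)
have hs : h + (2 * s)%:R = p%:R * h.
  rewrite pR mulrDl mul1r addrC (natrM _ 2 2) natrM; congr (_ + _).
  by transitivity (2%:R * s%:R * (h * 2%:R)); [rewrite h2 mulr1 | ring].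
have s1 : (1 : Zp) + (4 * s)%:R = p%:R * 1 by rewrite natrM addrC mulr1 pR.
rewrite (prod_nonunit (s := 2 * s) n _ hs) in Ph; last by lia.
rewrite (prod_nonunit (s := 4 * s) n _ s1) -?fact_prod in F; last by lia.
have Gh := padic_gammaDn p_odd h m; rewrite -/(U h) in Gh.
have G1 := padic_gammaDn p_odd (1 : Zp) m; rewrite -/(U 1) padic_gamma1 // in G1.
(* Since m is s modulo p, the reflection sign at 1 + m is the one at s + 1. *)
have R : Gamma (- m%:R) * Gamma (1 + m%:R) = (-1) ^+ s.+1.
  rewrite -[m%:R in X in _ * X]opprK -/(gamma_reflection _).
  rewrite -(gamma_reflectionC (- m%:R)) opprK -(gamma_reflection_nat p_odd); last by lia.
  apply: gamma_reflection_eq => //.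
  rewrite nat1r /m -addnS natrD natrM -[p%:R]expr1 padic_truncD.
  by rewrite padic_trunc_pX_eq0 ?add0r.
set g := Gamma (- m%:R) in R *.
have -> : Gamma (h + m%:R) * g = (-1) ^+ m * U h * g * Gamma h by rewrite Gh; ring.
rewrite [(-1) ^+ s * _]mulrA mulrK ?padic_gamma_unit //.
(* Up to sign, [g] inverts [U 1], the unit part of m!, which is thus cancelled without division. *)
have Rs : (-1) ^+ s * (-1) ^+ m * g * U 1 = 1.
  apply/eqP; rewrite -(inj_eq (can_inj (signrMK s))) mulr1 !mulrA -expr2 sqrr_sign.
  apply/eqP; move: R; rewrite G1 exprS => R.
  transitivity (- (g * ((-1) ^+ m * -1 * U 1))); first by ring.
  by rewrite R mulN1r opprK.
have m0 : m`!%:R != 0 :> Zp by rewrite Z0 -lt0n fact_gt0.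
apply: (mulIf m0); rewrite {2}F.
rewrite !natrM !natrX in Ph Pn *.
set A := 'C(2 * m, m)%:R in Ph *; set B := 'C(2 * n, n)%:R in Pn *.
transitivity (A * m`!%:R * 4%:R ^+ n); first by ring.
rewrite -Ph.
transitivity (B * n`!%:R * (4%:R ^+ m * p%:R ^+ n * U h * ((-1) ^+ s * (-1) ^+ m * g * U 1))).
  by rewrite Rs mulr1 -Pn; ring.
by ring.
Qed.

End PadicGamma.

(** * Descent from rational series to a congruence of Gamma_p values *)

Theorem theorem1p1 (p : nat) (p_pr : prime p) (p_mod4 : (p = 1 %[mod 4])%N)
    (r : nat) (r_ge1 : (1 <= r)%N) :
  padic_eqmod (2 * r)%N
    (ratr (hyp2F1 ((1 - p%:R ^+ r) / 2%:R) (1 / 2%:R) 1 2%:R /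
           hyp2F1 ((1 - p%:R ^+ (r - 1)%N) / 2%:R) (1 / 2%:R) 1 2%:R))
    (tofrac ((-1) ^+ ((p ^ 2 - 1) %/ 8)%N *
             padic_gamma (1 / 4%:R : padic_int p_pr) ^+ 2 /
             padic_gamma (1 / 2%:R : padic_int p_pr))).
Proof.
case: r r_ge1 => // r _; rewrite subSS subn0.
pose s := (p %/ 4)%N; pose n := (p ^ r %/ 4)%N; pose m := (p * n + s)%N.
have ps : p = (4 * s + 1)%N by rewrite [LHS](divn_eq p 4) p_mod4 mulnC.
have pr : (p ^ r = 4 * n + 1)%N.
  by rewrite [LHS](divn_eq _ 4) -modnXm p_mod4 modnXm exp1n mulnC.
have pr1 : (p ^ r.+1 = 4 * m + 1)%N.
  by rewrite expnS pr mulnDr muln1 /m mulnDr mulnCA {2}ps addnA.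
have p_odd : odd p by rewrite ps; lia.
have hypE k j : (p ^ k = 4 * j + 1)%N ->
    hyp2F1 ((1 - p%:R ^+ k) / 2%:R) (1 / 2%:R) 1 2%:R =
    'C(2 * j, j)%:R / 4%:R ^+ j :> rat.
  move=> kj; rewrite -hyp2F1_half_2; last exact: Num.Theory.pchar_num.
  congr (hyp2F1 _ _ _ _); rewrite -natrX kj natrD !natrM.
  by field.
rewrite (hypE _ _ pr) (hypE _ _ pr1).
have -> : 'C(2 * m, m)%:R / 4%:R ^+ m / ('C(2 * n, n)%:R / 4%:R ^+ n) =
    ('C(2 * m, m) * 4 ^ n)%:R / ('C(2 * n, n) * 4 ^ m)%:R :> rat.
  by rewrite !natrM !natrX invf_div mulrACA -invfM [_ * 4%:R ^+ m]mulrC.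
rewrite (ratr_div_nat _ _ (pchar_padic p_pr)).
set b := ('C(2 * n, n) * 4 ^ m)%N.
have b0 : tofrac (b%:R : padic_int p_pr) != 0.
  rewrite tofrac_eq0 padic_natr_eq0 -lt0n muln_gt0 bin_gt0 expn_gt0 andbT; lia.
rewrite -!(rmorph_nat (tofrac (R:=padic_int p_pr))) (central_binomial_ratio p_pr n ps).
rewrite rmorphM /= mulrAC mulfV // !mul1r.
(* Here [r] is the original exponent minus one. Congruence modulo p^(2 r + 2) is equality of the
   components of index 2 r + 1. *)
rewrite (_ : (2 * r.+1 = (2 * r).+2)%N); last by lia.
apply/padic_eqmod_trunc; rewrite -/m !padic_truncM; congr (_ * _); congr (_ * _).
  (* The exponent of the sign has the parity of s. *)
  suff -> : ((p ^ 2 - 1) %/ 8 = s + 2 * s ^ 2)%N.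
    by rewrite exprD exprM sqrrN !expr1n mulr1.
  have -> : (p ^ 2 - 1 = 8 * (s + 2 * s ^ 2))%N by rewrite ps; nia.
  by rewrite mulKn.
have u4 : (4%:R : padic_int p_pr) \is a GRing.unit.
  by rewrite (natrM _ 2 2) unitrM padic_nat_unit dvdn_prime2 //; lia.
have u2 : (2%:R : padic_int p_pr) \is a GRing.unit.
  by rewrite padic_nat_unit dvdn_prime2 //; lia.
(* This [x] centres the arguments at 1/4: 1/2 + m = 1/4 + x and -m = 1/4 - x. Its square is
   divisible by p^(2 r + 2), hence vanishes at the level considered. *)
pose x : padic_int p_pr := p%:R ^+ r.+1 * 4%:R^-1.
have xE : x = 4%:R^-1 + m%:R.
  by apply: (mulIr u4); rewrite /x mulrVK // mulrDl mulVr // -natrX pr1 natrD natrM; ring.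
have q2 : 2%:R^-1 = 4%:R^-1 + 4%:R^-1 :> padic_int p_pr.
  by apply: (mulIr u4); rewrite mulrDl !mulVr // (natrM _ 2 2) mulrA mulVr // mul1r.
rewrite {1}q2 -addrA -xE (_ : - m%:R = 4%:R^-1 - x); last by rewrite xE; ring.
rewrite -padic_truncM; apply: padic_gamma_even => //.
  exact: padic_trunc_pX_eq0.
by rewrite /x mulrACA -exprD; apply: padic_trunc_pX_eq0; lia.
Qed.
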